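(* Let $\Gamma$ be a metrized graph with $v \geq 3$ vertices and let $k$ be an integer with $1 \leq k \leq v-2$. For admissible contractions, $$\frac{(v-2)!}{(v-k-2)!}\,x(\Gamma) = \sum_{e_{i_1} \in E(\Gamma)}\frac{R_{i_1}}{L_{i_1}+R_{i_1}} \sum_{e_{i_2} \in E(\overline{\Gamma}_{i_1})}\frac{R_{i_2}}{L_{i_2}+R_{i_2}}\cdots\sum_{e_{i_k} \in E(\overline{\Gamma}_{i_1, \dots, i_{k-1}})}\frac{R_{i_k}}{L_{i_k}+R_{i_k}}\, x(\overline{\Gamma}_{i_1,\dots, i_k}),$$ and the same identity holds with $x$ replaced by $y$ throughout.
   Context: A metrized graph $\Gamma$ is a finite connected graph (multiple edges and self-loops allowed) each of whose edges is identified with a closed segment of positive length, with a finite nonempty vertex set $V(\Gamma)$ containing every point of valence $\neq2$; $v=\#V(\Gamma)$, $E(\Gamma)$ its edge set, $L_i$ the length of $e_i$. For an edge $e_i$ with end points $p_i,q_i$: if $\Gamma-e_i$ (interior deleted) is connected, $R_i$ is the effective resistance between $p_i,q_i$ in $\Gamma-e_i$ (edges as resistors of resistance equal to length), $R_{a_i,p}=\hat j_{p_i}(p,q_i)$, $R_{b_i,p}=\hat j_{q_i}(p,p_i)$ with $\hat j_z(x,y)$ the voltage function of $\Gamma-e_i$ (potential at $x$ when unit current enters at $y$, exits at $z$, potential $0$ at $z$); if $e_i$ is a bridge, $R_{a_i,p}=0,R_{b_i,p}=R_i$ for $p$ in the component of $\Gamma-e_i$ containing $p_i$ and $R_{a_i,p}=R_i,R_{b_i,p}=0$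 otherwise, and expressions in $R_i$ are interpreted as limits as $R_i\to\infty$; for a self-loop $R_i=0$. For a fixed vertex $p$ (values independent of $p$): $y(\Gamma)=\frac14\sum_{e_i}\frac{L_iR_i^2}{(L_i+R_i)^2}+\frac34\sum_{e_i}\frac{L_i(R_{a_i,p}-R_{b_i,p})^2}{(L_i+R_i)^2}$ and $x(\Gamma)=\sum_{e_i}\frac{L_i^2R_i}{(L_i+R_i)^2}+\frac34\sum_{e_i}\frac{L_iR_i^2}{(L_i+R_i)^2}-\frac34\sum_{e_i}\frac{L_i(R_{a_i,p}-R_{b_i,p})^2}{(L_i+R_i)^2}$. $\overline\Gamma_{i_1,\dots,i_k}$ is obtained by successively contracting $e_{i_1}\in E(\Gamma)$ to a point, then $e_{i_2}\in E(\overline\Gamma_{i_1})$, etc. (vertex sets being images); $L_{i_j},R_{i_j}$ are computed in the graph $\overline\Gamma_{i_1,\dots,i_{j-1}}$. A contraction is admissible if each contracted edge has distinct end points (self-loop terms vanish anyway since $R=0$). *)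

(* Defs.v *)
From HB Require Import structures.
From mathcomp Require Import all_boot all_order all_algebra.
From mathcomp Require Import all_classical all_reals all_analysis.
From Stdlib Require ClassicalEpsilon.
Set Implicit Arguments. Unset Strict Implicit. Unset Printing Implicit Defensive.
Import Order.TTheory GRing.Theory Num.Theory.
Import numFieldNormedType.Exports.
Local Open Scope ring_scope.

Section MetrizedGraphs.
Variable R : realType.

(* A metrized graph on the vertex set {0, ..., nv-1}: a list of edges
   (p, q, L) with end points p, q and length L; multiple edges and
   self-loops allowed.  Edge e_i is the i-th element of the list. *)
Record mgraph := MGraph { nv : nat; edges : seq (nat * nat * R) }.

Definition esrc (e : nat * nat * R) : nat := e.1.1.
Definition etgt (e : nat * nat * R) : nat := e.1.2.
Definition elen (e : nat * nat * R) : R := e.2.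

Definition closed_set (G : mgraph) (S : nat -> bool) : bool :=
  all (fun e => S (esrc e) == S (etgt e)) (edges G).

Definition same_comp (G : mgraph) (u w : nat) : Prop :=
  forall S, closed_set G S -> S u -> S w.

Definition connectedG (G : mgraph) : Prop :=
  forall u w, (u < nv G)%N -> (w < nv G)%N -> same_comp G u w.

Definition metrized (G : mgraph) : Prop :=
  [/\ (0 < nv G)%N,
      all (fun e => (esrc e < nv G)%N && (etgt e < nv G)%N && (0 < elen e))
          (edges G)
    & connectedG G].

(* current flowing out of vertex w through edge e, for potential f
   (edges are resistors of resistance = length) *)
Definition flow_out (f : nat -> R) (w : nat) (e : nat * nat * R) : R :=
  (((esrc e == w)%:R - (etgt e == w)%:R) * (f (esrc e) - f (etgt e))) / elen e.

(* f is the potential when unit current enters at y and exits at z,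
   with potential 0 at z (Kirchhoff's current law at every vertex). *)
Definition is_voltage (G : mgraph) (y z : nat) (f : nat -> R) : Prop :=
  f z = 0 /\
  forall w, (w < nv G)%N ->
    \sum_(e <- edges G) flow_out f w e = (w == y)%:R - (w == z)%:R.

Definition voltage (G : mgraph) (z x y : nat) : R :=
  ClassicalEpsilon.epsilon (inhabits 0)
    (fun r => exists f, is_voltage G y z f /\ f x = r).

Definition eff_res (G : mgraph) (p q : nat) : R := voltage G q p p.

Definition edge_of (G : mgraph) (i : nat) : nat * nat * R :=
  nth (0%N, 0%N, 0) (edges G) i.

Definition del_edge (G : mgraph) (i : nat) : mgraph :=
  MGraph (nv G) (take i (edges G) ++ drop i.+1 (edges G)).

(* Value of an edge expression F(L_i, R_i, R_{a_i,p}, R_{b_i,p}) for edge e_i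
   of G, with the bridge convention: R_{a_i,p}=0, R_{b_i,p}=R_i if p is in the
   component of p_i in Gamma - e_i, and R_{a_i,p}=R_i, R_{b_i,p}=0 otherwise,
   the expression being interpreted as the limit R_i -> +oo. *)
Definition edge_val (F : R -> R -> R -> R -> R) (G : mgraph) (i p : nat) : R :=
  let e := edge_of G i in
  let G' := del_edge G i in
  let a := esrc e in let b := etgt e in let L := elen e in
  if `[< connectedG G' >] then
    F L (eff_res G' a b) (voltage G' a p b) (voltage G' b p a)
  else
    lim ((if `[< same_comp G' a p >] then F L t 0 t else F L t t 0)
           @[t --> +oo])%classic.

Definition ratio_term (L Ri Ra Rb : R) : R := Ri / (L + Ri).

Definition y_term (L Ri Ra Rb : R) : R :=
  4^-1 * (L * Ri ^+ 2 / (L + Ri) ^+ 2)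
  + (3 / 4) * (L * (Ra - Rb) ^+ 2 / (L + Ri) ^+ 2).

Definition x_term (L Ri Ra Rb : R) : R :=
  L ^+ 2 * Ri / (L + Ri) ^+ 2
  + (3 / 4) * (L * Ri ^+ 2 / (L + Ri) ^+ 2)
  - (3 / 4) * (L * (Ra - Rb) ^+ 2 / (L + Ri) ^+ 2).

Definition yG (G : mgraph) (p : nat) : R :=
  \sum_(i < size (edges G)) edge_val y_term G i p.

Definition xG (G : mgraph) (p : nat) : R :=
  \sum_(i < size (edges G)) edge_val x_term G i p.

(* Contraction of edge e_i = (a, b, L) (a <> b): b is merged into a, vertex
   labels above b are shifted down by one, e_i is removed. *)
Definition relabel (a b w : nat) : nat :=
  let w1 := if w == b then a else w in
  if (b < w1)%N then w1.-1 else w1.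

Definition contract_vertex (G : mgraph) (i w : nat) : nat :=
  relabel (esrc (edge_of G i)) (etgt (edge_of G i)) w.

Definition contract (G : mgraph) (i : nat) : mgraph :=
  MGraph (nv G).-1
    (map (fun e => (contract_vertex G i (esrc e), contract_vertex G i (etgt e),
                    elen e))
         (edges (del_edge G i))).

Definition admissible (G : mgraph) (i : nat) : bool :=
  esrc (edge_of G i) != etgt (edge_of G i).

Fixpoint nested (F : mgraph -> nat -> R) (k : nat) (G : mgraph) (p : nat) : R :=
  match k with
  | 0%N => F G p
  | k'.+1 =>
      \sum_(i < size (edges G) | admissible G i)
        edge_val ratio_term G i p * nested F k' (contract G i) (contract_vertex G i p)
  end.

End MetrizedGraphs.

(* Main.v *)
(** Fix the base point [p] and let [g x] be the potential of a unit current
    from [x] to [p]; it represents evaluation for the Dirichlet energy: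
    [energy (g x) h = h x - h p].  For an edge [e = (a, b)] put
    [h_e = g a - g b], [r_e = h_e a - h_e b] (resistance in the whole graph) and
    [t_e = g a a - g b b].  Then [R_e / (L_e + R_e) = r_e / L_e],
    [y = sum_e (r_e^2 / 4 + 3 t_e^2 / 4) / L_e] and [x + y = sum_e r_e], bridges
    and loops included.  Contracting [e] replaces [g x y] by
    [g x y - h_e x h_e y / r_e], so for [k = 1] everything is a polynomial in
    [g] divided by [r_e].  Averaging with weights [r_e / L_e], the leading term
    gives [v - 1] by Foster's theorem, the cross terms give [-2] by the
    reproducing property, and the quartic term gives back [+1], because
    [(s-t)^4/4 + 3 (s^2-t^2)^2/4 = (s-t) (s^3-t^3)] turns it into the energy of
    [h_e] against [h_e^3].  The general case follows by induction on [k]. *)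
Require Import Defs.
From HB Require Import structures.
From mathcomp Require Import all_boot all_order all_algebra.
From mathcomp Require Import all_classical all_reals all_analysis.
From mathcomp Require Import ring lra zify.
Import Order.TTheory GRing.Theory Num.Theory.
Import numFieldNormedType.Exports.
Local Open Scope ring_scope.

Set Implicit Arguments.
Unset Strict Implicit.
Unset Printing Implicit Defensive.

(** * Dirichlet energy; existence and uniqueness of potentials *)

Section Energy.
Variable R : realType.
Implicit Types (G : mgraph R) (e : nat * nat * R) (f h : nat -> R).

Definition drop_along f e : R := f (esrc e) - f (etgt e).

Definition energy G f h : R :=
  \sum_(e <- edges G) drop_along f e * drop_along h e / elen e.

Definition dirac_at (w u : nat) : R := (u == w)%:R.

(** Kirchhoff's law in weak form, tested against an arbitrary [h]. *)
Definition potential G y z f : Prop :=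
  f z = 0 /\ forall h, energy G f h = h y - h z.

Lemma metrized_edge G e : metrized G -> e \in edges G ->
  [/\ (esrc e < nv G)%N, (etgt e < nv G)%N & 0 < elen e].
Proof.
by case=> _ /allP ok _ /ok /andP[/andP[]].
Qed.

Lemma energyC G f h : energy G f h = energy G h f.
Proof. by apply: eq_bigr => e _; rewrite (mulrC (drop_along f e)). Qed.

Lemma energyDl G f1 f2 h c :
  energy G (fun u => f1 u + c * f2 u) h = energy G f1 h + c * energy G f2 h.
Proof.
rewrite /energy mulr_sumr -big_split; apply: eq_bigr => e _ /=.
by rewrite /drop_along; ring.
Qed.

Lemma sum_dirac_at n (h : nat -> R) x : (x < n)%N ->
  \sum_(w < n) h w * dirac_at w x = h x.
Proof.
move=> xn; rewrite (bigD1 (Ordinal xn)) //= /dirac_at eqxx mulr1 big1 ?addr0 //.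
move=> w /negP nw; rewrite (_ : (x == w) = false) ?mulr0 //.
by apply/negP => /eqP xw; apply: nw; apply/eqP/val_inj.
Qed.

Lemma energy_dirac_at G f h : metrized G ->
  energy G f h = \sum_(w < nv G) h w * energy G f (dirac_at w).
Proof.
move=> mG; under eq_bigr do rewrite /energy mulr_sumr.
rewrite exchange_big; apply: eq_big_seq => e eG /=.
have [an bn _] := metrized_edge mG eG.
rewrite {2}/drop_along -(sum_dirac_at h an) -(sum_dirac_at h bn) -sumrB.
rewrite mulr_sumr mulr_suml; apply: eq_bigr => w _.
by rewrite /drop_along; ring.
Qed.

Lemma energy_flow G f w :
  energy G f (dirac_at w) = \sum_(e <- edges G) flow_out f w e.
Proof.
by apply: eq_bigr => e _; rewrite /flow_out (mulrC (drop_along f e)).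
Qed.

(** The current law at [w] is the weak equation tested against [dirac_at w], and these functions
    span all test functions on the vertices. *)
Lemma is_voltageP G y z f : metrized G -> (y < nv G)%N -> (z < nv G)%N ->
  is_voltage G y z f <-> potential G y z f.
Proof.
move=> mG yn zn; split=> -[fz fE]; split=> //; [move=> h|move=> w wn].
  rewrite energy_dirac_at // -(sum_dirac_at h yn) -(sum_dirac_at h zn) -sumrB.
  apply: eq_bigr => w _; rewrite energy_flow fE //.
  by rewrite /dirac_at (eq_sym y) (eq_sym z); ring.
by rewrite -energy_flow fE /dirac_at (eq_sym y) (eq_sym z).
Qed.

Lemma energy_term_ge0 G f e : metrized G -> e \in edges G ->
  0 <= drop_along f e * drop_along f e / elen e.
Proof.
move=> mG /(metrized_edge mG)[_ _ L0].
by apply: divr_ge0; [rewrite -expr2 sqr_ge0|exact: ltW].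
Qed.

(** All terms are nonnegative, so every drop vanishes; the level set of [f] through [u] is then
    closed under edges, and connectedness puts every vertex in it. *)
Lemma energy_eq0 G f : metrized G -> energy G f f = 0 ->
  forall u w, (u < nv G)%N -> (w < nv G)%N -> f u = f w.
Proof.
move=> mG /eqP; rewrite /energy big_seq psumr_eq0; last first.
  by move=> e; apply: energy_term_ge0.
move=> /allP f0 u w un wn; have [_ _ cG] := mG.
apply/esym/eqP; apply: (cG u w un wn (fun k => f k == f u)) => //.
apply/allP => e eG; have := f0 e eG; rewrite eG implyTb.
have [_ _ L0] := metrized_edge mG eG.
rewrite mulf_eq0 invr_eq0 (gt_eqF L0) orbF mulf_eq0 orbb subr_eq0.
by move=> /eqP ->.
Qed.

Lemma potential_uniq G y z f1 f2 x : metrized G -> (z < nv G)%N ->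
  (x < nv G)%N -> potential G y z f1 -> potential G y z f2 -> f1 x = f2 x.
Proof.
move=> mG zn xn [z1 E1] [z2 E2].
have /(energy_eq0 mG)/(_ x z xn zn) :
    energy G (fun u => f1 u + -1 * f2 u) (fun u => f1 u + -1 * f2 u) = 0.
  by rewrite energyDl E1 E2; ring.
by rewrite z1 z2 => /eqP; lra.
Qed.

Lemma voltage_potential G y z x f : metrized G -> (y < nv G)%N ->
  (z < nv G)%N -> (x < nv G)%N -> potential G y z f -> voltage G z x y = f x.
Proof.
move=> mG yn zn xn fP; rewrite /voltage.
have ex : exists r, exists f0, is_voltage G y z f0 /\ f0 x = r.
  by exists (f x), f; split=> //; apply/is_voltageP.
have [f0 [/is_voltageP f0P <-]] :=
  ClassicalEpsilon.epsilon_spec (inhabits (0 : R)) _ ex.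
by apply: potential_uniq mG zn xn (f0P mG yn zn) fP.
Qed.

(** The energy form is degenerate on constants. Adding the rank one form [f z * h z] grounds [z] and
    gives an invertible matrix [M]; the grounded solution turns out to vanish at [z], so it solves
    the original problem. *)
Lemma potential_exists G y z : metrized G -> (y < nv G)%N -> (z < nv G)%N ->
  exists f, potential G y z f.
Proof.
move=> mG yn zn; set n := nv G in yn zn *.
pose ext (v : 'rV[R]_n) (k : nat) : R := \sum_(u < n) v 0 u * dirac_at u k.
pose M : 'M[R]_n := \matrix_(u, w)
  (energy G (dirac_at u) (dirac_at w) + dirac_at z u * dirac_at z w).
have extE v (u : 'I_n) : ext v u = v 0 u.
  rewrite /ext (bigD1 u) //= /dirac_at eqxx mulr1 big1 ?addr0 // => w nw.
  by rewrite eq_sym val_eqE (negPf nw) mulr0.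
have ME v (w : 'I_n) :
    (v *m M) 0 w = energy G (ext v) (dirac_at w) + ext v z * dirac_at z w.
  rewrite mxE /ext [in RHS]energyC energy_dirac_at // mulr_suml -big_split.
  apply: eq_bigr => u _ /=; rewrite mxE -/(ext v u) extE energyC /dirac_at.
  by rewrite (eq_sym (u : nat) z); ring.
have MT v h : \sum_(w < n) h (w : nat) * (v *m M) 0 w
              = energy G (ext v) h + ext v z * h z.
  rewrite energy_dirac_at // -(sum_dirac_at h zn) mulr_sumr -big_split.
  apply: eq_bigr => w _ /=; rewrite ME /dirac_at (eq_sym (w : nat) z); ring.
have Mu : M \in unitmx.
  rewrite -row_free_unit; apply: inj_row_free => v vM.
  (* A kernel vector paired with itself makes its energy plus the square of its value at [z] zero,
     so it is constant and vanishes at [z]. *)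
  have := MT v (ext v); rewrite vM big1 => [/esym E0|w _]; last first.
    by rewrite mxE mulr0.
  have e0 : 0 <= energy G (ext v) (ext v).
    by rewrite /energy big_seq sumr_ge0 // => e; apply: energy_term_ge0.
  have z0 : ext v z = 0 by apply/eqP; rewrite -sqrf_eq0; apply/eqP; nra.
  have := energy_eq0 mG (f := ext v); rewrite -/n => cst.
  apply/rowP => u; rewrite mxE -extE -[RHS]z0; apply: cst => //.
  by move: E0; rewrite z0 mul0r addr0.
pose c : 'rV[R]_n := \row_w (dirac_at w y - dirac_at w z).
pose v := c *m invmx M; exists (ext v).
have vE h : energy G (ext v) h + ext v z * h z = h y - h z.
  rewrite -MT mulmxKV // -(sum_dirac_at h yn) -(sum_dirac_at h zn) -sumrB.
  by apply: eq_bigr => w _; rewrite mxE; ring.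
have z0 : ext v z = 0.
  (* Constants pair to zero in energy, so the test function 1 isolates [ext v z]. *)
  have := vE (fun=> 1); rewrite energyC /energy big1 => [|e _].
    by rewrite add0r mulr1 subrr.
  by rewrite /drop_along subrr !mul0r.
by split=> // h; rewrite -vE z0 mul0r addr0.
Qed.

End Energy.

(** * The Green function at a base point and the edge quantities it determines *)

Section Green.
Variable R : realType.
Implicit Types (G : mgraph R) (e : nat * nat * R) (h : nat -> R)
  (g : nat -> nat -> R).

Definition green G p g : Prop :=
  forall x, (x < nv G)%N -> potential G x p (g x).

Definition edge_pot g e (x : nat) : R := g (esrc e) x - g (etgt e) x.

Definition edge_res g e : R := drop_along (edge_pot g e) e.

(* As [g x x] is the effective resistance between [x] and the base point, this
   is L_e (R_a - R_b) / (L_e + R_e) in the notation of the paper, while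
   [edge_res] is L_e R_e / (L_e + R_e). *)
Definition edge_tilt g e : R := drop_along (fun x => g x x) e.

(** The summand of y in a form that covers bridges without a limit. *)
Definition y_local g e : R :=
  (4^-1 * edge_res g e ^+ 2 + 3 / 4 * edge_tilt g e ^+ 2) / elen e.

Lemma green_exists G p : metrized G -> (p < nv G)%N -> exists g, green G p g.
Proof.
move=> mG pn.
have ex x : exists f, (x < nv G)%N -> potential G x p f.
  have [xn|_] := ltnP x (nv G); last by exists (fun=> 0).
  by have [f fP] := potential_exists mG xn pn; exists f.
by have [g gP] := choice ex; exists g.
Qed.

Section GreenTheory.
Variables (G : mgraph R) (p : nat) (g : nat -> nat -> R).
Hypotheses (mG : metrized G) (pn : (p < nv G)%N) (gP : green G p g).

(** Both sides are the energy of [g x] against [g y]. *)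
Lemma green_sym x y : (x < nv G)%N -> (y < nv G)%N -> g x y = g y x.
Proof.
move=> xn yn; have [x0 xE] := gP xn; have [y0 yE] := gP yn.
by have := xE (g y); rewrite energyC yE x0 y0 !subr0.
Qed.

Lemma energy_edge_pot e h : e \in edges G ->
  energy G (edge_pot g e) h = drop_along h e.
Proof.
move=> eG; have [an bn _] := metrized_edge mG eG.
transitivity (energy G (g (esrc e)) h + -1 * energy G (g (etgt e)) h).
  by rewrite -energyDl; apply: eq_bigr => k _; rewrite /drop_along /edge_pot; ring.
by rewrite (gP an).2 (gP bn).2 /drop_along; ring.
Qed.

Lemma edge_pot_base e : e \in edges G -> edge_pot g e p = 0.
Proof.
move=> eG; have [an bn _] := metrized_edge mG eG.
by rewrite /edge_pot (gP an).1 (gP bn).1 subrr.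
Qed.

Lemma edge_potE e x : e \in edges G -> (x < nv G)%N ->
  edge_pot g e x = drop_along (g x) e.
Proof.
move=> eG xn; have [an bn _] := metrized_edge mG eG.
by rewrite /edge_pot /drop_along !(green_sym xn).
Qed.

Lemma edge_tiltE e : e \in edges G ->
  edge_tilt g e = edge_pot g e (esrc e) + edge_pot g e (etgt e).
Proof.
move=> eG; have [an bn _] := metrized_edge mG eG.
by rewrite /edge_tilt /edge_pot /drop_along (green_sym an bn); ring.
Qed.

(** Otherwise h_e has zero energy and is constant on the vertices, so it pairs to 0 with the
    indicator of the source, where the reproducing property gives 1. *)
Lemma edge_res_neq0 e : e \in edges G -> esrc e != etgt e -> edge_res g e != 0.
Proof.
move=> eG ab; apply/eqP => r0; have [an bn _] := metrized_edge mG eG.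
have := energy_edge_pot (edge_pot g e) eG; rewrite -/(edge_res g e) r0.
move=> /(energy_eq0 mG) cst.
have := energy_edge_pot (dirac_at R (esrc e)) eG.
rewrite /energy big1_seq => [|k /andP[_ kG]]; last first.
  have [cn dn _] := metrized_edge mG kG.
  by rewrite {1}/drop_along (cst _ _ cn dn) subrr !mul0r.
rewrite /drop_along /dirac_at eqxx eq_sym (negPf ab) subr0 => /eqP.
by rewrite eq_sym oner_eq0.
Qed.

End GreenTheory.

(** * Splitting off one edge *)

Section DeleteEdge.
Variables (G : mgraph R) (i : nat).
Hypothesis iG : (i < size (edges G))%N.
Let e := edge_of G i.
Let G' := del_edge G i.

Lemma edge_of_mem : e \in edges G.
Proof. exact: mem_nth. Qed.

Lemma sum_del_edge (F : nat * nat * R -> R) :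
  \sum_(k <- edges G) F k = F e + \sum_(k <- edges G') F k.
Proof.
rewrite -[in LHS](cat_take_drop i (edges G)) (drop_nth (0%N, 0%N, 0) iG).
by rewrite /G' /= !big_cat big_cons /= addrCA.
Qed.

Lemma energy_del_edge f h :
  energy G f h = drop_along f e * drop_along h e / elen e + energy G' f h.
Proof. exact: sum_del_edge. Qed.

Lemma mem_del_edge k : k \in edges G' -> k \in edges G.
Proof. by rewrite mem_cat => /orP[/mem_take|/mem_drop]. Qed.

Lemma metrized_del_edge : metrized G -> connectedG G' -> metrized G'.
Proof.
move=> [n0 /allP ok _] cG'; split=> //.
by apply/allP => k /mem_del_edge /ok.
Qed.

End DeleteEdge.

(** * Edge values through the Green function, for bridges and non-bridges *)

Section EdgeValue.
Variables (G : mgraph R) (p i : nat) (g : nat -> nat -> R).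
Hypotheses (mG : metrized G) (pn : (p < nv G)%N) (gP : green G p g).
Hypothesis iG : (i < size (edges G))%N.
Let e := edge_of G i.
Let a := esrc e.
Let b := etgt e.
Let L := elen e.
Let r := edge_res g e.
Let G' := del_edge G i.
Let hp := edge_pot g e.
Let eG : e \in edges G := edge_of_mem iG.

Lemma elen_gt0 : 0 < L.
Proof. by have [] := metrized_edge mG eG. Qed.

(** The current through [e] is [r / L]; what remains of the unit current flows through the rest of
    the graph. *)
Lemma energy_edge_pot_del h :
  energy G' hp h = (L - r) / L * drop_along h e.
Proof.
have L0 := elen_gt0.
have := energy_edge_pot mG gP h eG; rewrite (energy_del_edge iG).
rewrite -/e -/G' -/(edge_res g e) -/r -/L => E.
apply: (addrI (r * drop_along h e / L)); rewrite E; field.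
by rewrite gt_eqF.
Qed.

Lemma edge_res_neq_len : metrized G' -> L - r != 0.
Proof.
move=> mG'; apply/eqP => Lr; have [an bn _] := metrized_edge mG eG.
have := energy_edge_pot_del hp; rewrite Lr mul0r mul0r => /(energy_eq0 mG').
move=> /(_ a b an bn) hab; move: Lr; rewrite /r /edge_res /drop_along.
rewrite -/hp -/a -/b hab subrr subr0 => L0.
by have := elen_gt0; rewrite L0 ltxx.
Qed.

(** Scaled by [L / (L - r)], h_e carries a unit current in [G']. It is shifted to vanish at [b], or
    negated and shifted to vanish at [a]; since h_e is 0 at [p], only the shift survives there. *)
Lemma edge_val_nonbridge F : connectedG G' ->
  edge_val F G i p =
  F L (L * r / (L - r)) (L * hp a / (L - r)) (- (L * hp b / (L - r))).
Proof.
move=> cG'; have mG' := metrized_del_edge mG cG'.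
have Lr := edge_res_neq_len mG'; have L0 := elen_gt0.
have [an bn _] := metrized_edge mG eG.
have hp0 : hp p = 0 by apply: (edge_pot_base mG gP).
have pab : potential G' a b (fun u => - hp b * (L / (L - r)) + L / (L - r) * hp u).
  split=> [|h]; first by ring.
  rewrite energyDl energy_edge_pot_del /energy big1 => [|k _].
    by rewrite /drop_along -/a -/b; field; rewrite Lr gt_eqF.
  by rewrite /drop_along subrr !mul0r.
have pba : potential G' b a (fun u => hp a * (L / (L - r)) + - (L / (L - r)) * hp u).
  split=> [|h]; first by ring.
  rewrite energyDl energy_edge_pot_del /energy big1 => [|k _].
    by rewrite /drop_along -/a -/b; field; rewrite Lr gt_eqF.
  by rewrite /drop_along subrr !mul0r.
rewrite /edge_val -/e -/G' -/a -/b -/L; case: asboolP => // _.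
rewrite /eff_res (voltage_potential mG' an bn an pab).
rewrite (voltage_potential mG' bn an pn pba).
rewrite (voltage_potential mG' an bn pn pab) hp0 /=.
congr F; rewrite ?mulr0 ?addr0 ?mulNr; try by ring.
by rewrite /r /edge_res /drop_along -/hp -/a -/b; ring.
Qed.

Lemma bridge_cut : ~ connectedG G' -> exists k : nat -> R,
  [/\ forall f, energy G' k f = 0, forall x, k x = 0 \/ k x = 1
    & (k a = 1 /\ k b = 0) \/ (k a = 0 /\ k b = 1)].
Proof.
move=> /existsNP[u /existsNP[w /not_implyP[un /not_implyP[wn]]]].
move=> /existsNP[S /not_implyP[cS /not_implyP[Su /negP Sw]]].
(* If [e] did not cross [S], then [S] would be closed in [G] and separate [u] from [w]. *)
have Sab : S a != S b.
  apply/negP => Sab; case: mG => _ _ /(_ u w un wn S) cG.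
  move/negP: Sw; apply; apply: cG => //; apply/allP => k.
  rewrite -(cat_take_drop i (edges G)) (drop_nth (0%N, 0%N, 0) iG).
  rewrite mem_cat inE => /or3P[kG|/eqP -> //|kG];
    by move/allP: cS; apply; rewrite mem_cat kG ?orbT.
exists (fun x => (S x)%:R); split=> [f|x|].
- rewrite /energy big1_seq // => k /andP[_ kG].
  move/allP: cS => /(_ k kG)/eqP Sk.
  by rewrite /drop_along Sk subrr !mul0r.
- by case: (S x); [right|left].
- by move: Sab; case: (S a); case: (S b) => // _; [left|right].
Qed.

(** In [G] the cut indicator [k] drops only along [e], so its pairings see that edge alone. Paired
    with h_e it yields [r = L]; paired with [g a] and [g b] it yields the tilt up to sign. *)
Lemma bridge_edge_res : ~ connectedG G' -> r = L /\ edge_tilt g e ^+ 2 = L ^+ 2.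
Proof.
move=> /bridge_cut[k [kE k01 kab]]; have L0 := elen_gt0.
have [an bn _] := metrized_edge mG eG.
have EG f : energy G k f = drop_along k e * drop_along f e / L.
  by rewrite (energy_del_edge iG) kE addr0.
have Eh : drop_along k e = drop_along k e * r / L.
  by rewrite -EG energyC (energy_edge_pot mG gP).
have E1 x : (x < nv G)%N ->
    k x - k p = drop_along k e * drop_along (g x) e / L.
  by move=> xn; rewrite -EG energyC (gP xn).2.
have Ea := E1 a an; have Eb := E1 b bn.
have Et : k a + k b - 2 * k p = drop_along k e * edge_tilt g e / L.
  transitivity ((k a - k p) + (k b - k p)); first by ring.
  rewrite Ea Eb /edge_tilt /drop_along -/a -/b (green_sym gP an bn).
  by ring.
have k2 : drop_along k e ^+ 2 = 1.
  by rewrite /drop_along -/a -/b; case: kab => -[-> ->]; ring.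
have k0 : drop_along k e != 0 by rewrite -sqrf_eq0 k2 oner_eq0.
split.
  apply: (mulfI k0); rewrite [in RHS]Eh; field.
  by rewrite gt_eqF.
have -> : edge_tilt g e = drop_along k e * L * (k a + k b - 2 * k p).
  rewrite Et -[LHS]mul1r -k2; field.
  by rewrite gt_eqF.
rewrite !exprMn k2 mul1r -[RHS]mulr1; congr (_ * _).
(* Here [k a + k b] is 1 and [k p] is 0 or 1, so the factor is 1 or -1. *)
by case: (k01 p) => ->; case: kab => -[-> ->]; ring.
Qed.

Lemma near_pinfty_addr_gt0 : (\forall t \near +oo%R, 0 < L + t)%classic.
Proof.
near=> t; apply: addr_gt0 (elen_gt0) _.
by near: t; exact: nbhs_pinfty_gt.
Unshelve. all: by end_near. Qed.

Lemma cvg_inv_pinfty : ((L + t)^-1 @[t --> +oo%R] --> (0 : R))%classic.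
Proof.
by have /gtr0_cvgV0[_ /(_ (cvg_addrl L))] := near_pinfty_addr_gt0.
Qed.

Lemma cvg_ratio_pinfty : (t / (L + t) @[t --> +oo%R] --> (1 : R))%classic.
Proof.
apply: (@cvg_trans _ ((1 - L * (L + t)^-1) @[t --> +oo%R])%classic).
  apply: near_eq_cvg; near=> t.
  have : L + t != 0 by rewrite gt_eqF //; near: t; exact: near_pinfty_addr_gt0.
  by move=> D0; field.
have := cvgB (cvg_cst (1 : R)) (cvgM (cvg_cst L) cvg_inv_pinfty).
by rewrite mulr0 subr0; apply.
Unshelve. all: by end_near. Qed.

Lemma edge_val_ratio : edge_val (@ratio_term R) G i p = r / L.
Proof.
have L0 := elen_gt0; have Ln : L != 0 by rewrite gt_eqF.
have [cG'|ncG'] := pselect (connectedG G').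
  have Lr := edge_res_neq_len (metrized_del_edge mG cG').
  rewrite edge_val_nonbridge // /ratio_term.
  have -> : L + L * r / (L - r) = L ^+ 2 / (L - r) by field.
  by field; rewrite Ln.
have [-> _] := bridge_edge_res ncG'; rewrite divff //.
rewrite /edge_val -/e -/G' -/a -/b -/L; case: asboolP => // _.
by case: asboolP => _; apply: cvg_lim => //; exact: cvg_ratio_pinfty.
Qed.

Lemma edge_val_y : edge_val (@y_term R) G i p = y_local g e.
Proof.
have L0 := elen_gt0; have Ln : L != 0 by rewrite gt_eqF.
rewrite /y_local -/r -/L.
have [cG'|ncG'] := pselect (connectedG G').
  have Lr := edge_res_neq_len (metrized_del_edge mG cG').
  rewrite edge_val_nonbridge // /y_term (edge_tiltE mG gP eG).
  have -> : L + L * r / (L - r) = L ^+ 2 / (L - r) by field.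
  rewrite -/hp -/a -/b; field; by rewrite Ln.
have [-> ->] := bridge_edge_res ncG'.
(* Under either bridge convention R_a - R_b is [t] up to sign, so the two parts of the term merge
   into [L * (t / (L + t)) ^+ 2]. *)
have -> : (4^-1 * L ^+ 2 + 3 / 4 * L ^+ 2) / L = L * 1 ^+ 2 by field.
have lim1 : (L * (t / (L + t)) ^+ 2 @[t --> +oo%R] --> L * 1 ^+ 2)%classic.
  apply: cvgM; first exact: cvg_cst.
  by rewrite !expr2; apply: cvgM; exact: cvg_ratio_pinfty.
have E1 : (fun t : R => y_term L t 0 t) = (fun t => L * (t / (L + t)) ^+ 2).
  by apply/funext => t; rewrite /y_term -!exprVn; set w := (L + t)^-1; field.
have E2 : (fun t : R => y_term L t t 0) = (fun t => L * (t / (L + t)) ^+ 2).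
  by apply/funext => t; rewrite /y_term -!exprVn; set w := (L + t)^-1; field.
rewrite /edge_val -/e -/G' -/a -/b -/L; case: asboolP => // _.
by case: asboolP => _; apply: cvg_lim => //; rewrite ?E1 ?E2; exact: lim1.
Qed.

(** The x and y terms add up to L R / (L + R), which is [r]. For a bridge the x term tends to 0,
    while [r] and [y_local g e] both equal [L]. *)
Lemma edge_val_x : edge_val (@x_term R) G i p = r - y_local g e.
Proof.
have L0 := elen_gt0; have Ln : L != 0 by rewrite gt_eqF.
rewrite /y_local -/r -/L.
have [cG'|ncG'] := pselect (connectedG G').
  have Lr := edge_res_neq_len (metrized_del_edge mG cG').
  rewrite edge_val_nonbridge // /x_term (edge_tiltE mG gP eG).
  have -> : L + L * r / (L - r) = L ^+ 2 / (L - r) by field.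
  rewrite -/hp -/a -/b; field; by rewrite Ln.
have [-> ->] := bridge_edge_res ncG'.
have -> : L - (4^-1 * L ^+ 2 + 3 / 4 * L ^+ 2) / L = L * 1 * (L * 0) by field.
have lim1 : (L * (t / (L + t)) * (L / (L + t)) @[t --> +oo%R]
             --> L * 1 * (L * 0))%classic.
  by apply: cvgM; apply: cvgM;
    [exact: cvg_cst|exact: cvg_ratio_pinfty|exact: cvg_cst|exact: cvg_inv_pinfty].
have E1 : (fun t : R => x_term L t 0 t) =
    (fun t => L * (t / (L + t)) * (L / (L + t))).
  by apply/funext => t; rewrite /x_term expr2 invfM; ring.
have E2 : (fun t : R => x_term L t t 0) =
    (fun t => L * (t / (L + t)) * (L / (L + t))).
  by apply/funext => t; rewrite /x_term expr2 invfM; ring.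
rewrite /edge_val -/e -/G' -/a -/b -/L; case: asboolP => // _.
by case: asboolP => _; apply: cvg_lim => //; rewrite ?E1 ?E2; exact: lim1.
Qed.

End EdgeValue.
End Green.

(** * Vertex labels under contraction *)

Lemma relabel_lt n a b w :
  (a < n)%N -> (b < n)%N -> a != b -> (w < n)%N -> (relabel a b w < n.-1)%N.
Proof.
move=> an bn /eqP ab wn; rewrite /relabel; case: (w =P b) => [_|wb].
  by case: (ltnP b a); lia.
by case: (ltnP b w); lia.
Qed.

Lemma relabel_merge a b : a != b -> relabel a b b = relabel a b a.
Proof. by move=> ab; rewrite /relabel eqxx (negPf ab). Qed.

(** [bump b] skips the label [b], so it lifts each contracted vertex to a representative, the merged
    one to [a]. *)
Lemma bump_relabel a b w :
  a != b -> bump b (relabel a b w) = if w == b then a else w.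
Proof.
move=> /eqP ab; rewrite /relabel /bump; case: (w =P b) => [_|wb].
  by case: (ltnP b a); case: leqP; lia.
by case: (ltnP b w); case: leqP; lia.
Qed.

Lemma relabel_bump a b w : relabel a b (bump b w) = w.
Proof.
rewrite /relabel /bump; case: (leqP b w) => bw.
  by case: eqP => [|_]; [lia|case: ltnP; lia].
by case: eqP => [|_]; [lia|case: ltnP; lia].
Qed.

Lemma bump_lt n b w : (w < n.-1)%N -> (bump b w < n)%N.
Proof. by rewrite /bump; case: leqP; lia. Qed.

(** * The Green function of the contracted graph *)

Section ContractEdge.
Variables (R : realType) (G : mgraph R) (p i : nat) (g : nat -> nat -> R).
Hypotheses (mG : metrized G) (pn : (p < nv G)%N) (gP : green G p g).
Hypothesis iG : (i < size (edges G))%N.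
Hypothesis adm : admissible G i.
Let e := edge_of G i.
Let a := esrc e.
Let b := etgt e.
Let G1 := Defs.contract G i.
Let c := contract_vertex G i.
Let eG : e \in edges G := edge_of_mem iG.
Let hp := edge_pot g e.
Let r := edge_res g e.

Definition edge_image (k : nat * nat * R) := (c (esrc k), c (etgt k), elen k).

Lemma contract_vertex_lt w : (w < nv G)%N -> (c w < nv G1)%N.
Proof.
have [an bn _] := metrized_edge mG eG.
exact: relabel_lt.
Qed.

Lemma contract_vertex_merge : c b = c a.
Proof. exact: relabel_merge. Qed.

Lemma metrized_contract : metrized G1.
Proof.
have [an bn _] := metrized_edge mG eG; have [n0 ok cG] := mG.
split.
- exact: leq_ltn_trans (contract_vertex_lt pn).
- apply/allP => _ /mapP[k /mem_del_edge kG ->].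
  have [kn ln L0] := metrized_edge mG kG.
  by rewrite L0 !contract_vertex_lt.
- move=> u w un wn S cS.
  (* Vertices are lifted to [G], where the preimage of [S] is closed because the ends of [e] have
     the same image. *)
  rewrite -(relabel_bump a b u) -(relabel_bump a b w).
  apply: (cG _ _ _ _ (fun x => S (c x))); try exact: bump_lt.
  apply/allP => k; rewrite -(cat_take_drop i (edges G)).
  rewrite (drop_nth (0%N, 0%N, 0) iG) mem_cat inE => kG.
  have : k = e \/ k \in edges (del_edge G i).
    rewrite mem_cat; case/or3P: kG => [->|/eqP ->|->]; [right|left|right] => //.
    by rewrite orbT.
  case=> [->|kG1]; first by rewrite -/b contract_vertex_merge.
  have /allP/(_ (edge_image k)) := cS; apply; exact: (map_f edge_image kG1).
Qed.

(** Keeps [e] in the sum as a loop at the merged vertex; the subtracted loop term is zero in every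
    application. *)
Lemma sum_contract (F : nat -> nat -> R -> R) :
  \sum_(k <- edges G1) F (esrc k) (etgt k) (elen k) =
  \sum_(k <- edges G) F (c (esrc k)) (c (etgt k)) (elen k)
    - F (c a) (c a) (elen e).
Proof.
rewrite big_map (sum_del_edge iG) -/e -/a -/b.
rewrite contract_vertex_merge addrC addKr; exact: eq_bigr.
Qed.

Lemma energy_contract f h :
  energy G1 f h = energy G (fun x => f (c x)) (fun x => h (c x)).
Proof.
rewrite /energy /drop_along.
rewrite (sum_contract (fun x y l => (f x - f y) * (h x - h y) / l)).
by rewrite subrr !mul0r subr0.
Qed.

(** [g x] minus its energy-orthogonal projection onto h_e, as h_e has energy [r] and pairs with
    [g x] to [hp x]. *)
Definition pinch_green (x y : nat) : R := g x y - hp x * hp y / r.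

Let r0 : r != 0.
Proof. exact: (edge_res_neq0 mG gP eG). Qed.

Let rE : r = hp a - hp b.
Proof. by []. Qed.

Lemma pinch_green_sym x y : (x < nv G)%N -> (y < nv G)%N ->
  pinch_green x y = pinch_green y x.
Proof.
by move=> xn yn; rewrite /pinch_green (green_sym gP xn yn) (mulrC (hp x)).
Qed.

Lemma pinch_green_merge y : pinch_green a y = pinch_green b y.
Proof.
apply/eqP; rewrite -subr_eq0; apply/eqP.
transitivity (hp y - (hp a - hp b) * hp y / r).
  have hy : hp y = g a y - g b y by [].
  by rewrite /pinch_green hy; ring.
by rewrite -rE; field.
Qed.

Definition contract_green (x y : nat) : R := pinch_green (bump b x) (bump b y).

(** [pinch_green] does not distinguish [a] from [b] in either argument, so the choice of
    representative is immaterial. *)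
Lemma contract_greenE x y : (x < nv G)%N -> (y < nv G)%N ->
  contract_green (c x) (c y) = pinch_green x y.
Proof.
have [an bn _] := metrized_edge mG eG.
move=> xn yn; rewrite /contract_green /c /contract_vertex -/e -/a -/b.
rewrite !bump_relabel //; case: eqP => [->|_]; case: eqP => [->|_] //.
- rewrite pinch_green_merge pinch_green_sym // pinch_green_merge.
  exact: pinch_green_sym.
- exact: pinch_green_merge.
- by rewrite pinch_green_sym // pinch_green_merge pinch_green_sym.
Qed.

Lemma energy_pinch_green x h : (x < nv G)%N ->
  energy G (pinch_green x) h = h x - h p - hp x / r * drop_along h e.
Proof.
move=> xn; rewrite -(gP xn).2 -(energy_edge_pot mG gP h eG) -mulNr -energyDl.
by apply: eq_bigr => k _; rewrite /drop_along /pinch_green -/hp; ring.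
Qed.

Lemma contract_green_green : green G1 (c p) contract_green.
Proof.
have [an bn _] := metrized_edge mG eG.
move=> x' xn'; have xn : (bump b x' < nv G)%N by exact: bump_lt.
have -> : x' = c (bump b x') by rewrite /c /contract_vertex relabel_bump.
split=> [|h].
  rewrite contract_greenE // /pinch_green (gP xn).1.
  by rewrite {2}/hp (edge_pot_base mG gP eG) mulr0 mul0r subr0.
rewrite energy_contract.
transitivity (energy G (pinch_green (bump b x')) (fun y => h (c y))).
  apply: eq_big_seq => k kG; have [kn ln _] := metrized_edge mG kG.
  by rewrite /drop_along !contract_greenE.
(* A function pulled back along [c] has no drop along [e], which kills the correction term. *)
rewrite energy_pinch_green // /drop_along -/a -/b contract_vertex_merge.
by rewrite subrr mulr0 subr0.
Qed.

Lemma edge_res_contract k : k \in edges G ->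
  edge_res contract_green (edge_image k) =
  edge_res g k - drop_along hp k ^+ 2 / r.
Proof.
move=> kG; have [kn ln _] := metrized_edge mG kG.
rewrite /edge_res /drop_along /edge_pot /= !contract_greenE //.
by rewrite /pinch_green; ring.
Qed.

Lemma edge_tilt_contract k : k \in edges G ->
  edge_tilt contract_green (edge_image k) =
  edge_tilt g k - drop_along (fun x => hp x ^+ 2) k / r.
Proof.
move=> kG; have [kn ln _] := metrized_edge mG kG.
rewrite /edge_tilt /drop_along /= !contract_greenE //.
by rewrite /pinch_green; ring.
Qed.

Lemma sum_edge_res_contract :
  \sum_(k <- edges G1) edge_res contract_green k =
  \sum_(k <- edges G) (edge_res g k - drop_along hp k ^+ 2 / r).
Proof.
rewrite (sum_contract (fun x y l => edge_res contract_green (x, y, l))).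
rewrite /edge_res {2}/drop_along /= subrr subr0.
by apply: eq_big_seq => k; exact: edge_res_contract.
Qed.

Lemma sum_y_local_contract :
  \sum_(k <- edges G1) y_local contract_green k =
  \sum_(k <- edges G)
    (4^-1 * (edge_res g k - drop_along hp k ^+ 2 / r) ^+ 2
     + 3 / 4 * (edge_tilt g k - drop_along (fun x => hp x ^+ 2) k / r) ^+ 2)
    / elen k.
Proof.
rewrite (sum_contract (fun x y l => y_local contract_green (x, y, l))).
rewrite {2}/y_local /edge_res /edge_tilt /drop_along /edge_pot /=.
rewrite !subrr !expr0n !mulr0 addr0 mul0r subr0.
apply: eq_big_seq => k kG; rewrite -edge_res_contract //.
by rewrite -edge_tilt_contract.
Qed.

End ContractEdge.

(** * Weighted averages over the contracted edge *)

Section Averaging.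
Variables (R : realType) (G : mgraph R) (p : nat) (g : nat -> nat -> R).
Hypotheses (mG : metrized G) (pn : (p < nv G)%N) (gP : green G p g).

Let cross (e k : nat * nat * R) : R := drop_along (edge_pot g e) k.
Let cross2 (e k : nat * nat * R) : R :=
  drop_along (fun x => edge_pot g e x ^+ 2) k.

Lemma cross_sym e k : e \in edges G -> k \in edges G -> cross e k = cross k e.
Proof.
move=> eG kG; rewrite /cross -(energy_edge_pot mG gP _ kG).
by rewrite energyC (energy_edge_pot mG gP _ eG).
Qed.

(** The trace of energy pairings of [g w] with the indicator of [w], computed twice: edge by edge it
    gives the left side; by the reproducing property each [w] other than [p] contributes 1, and [p]
    contributes 0. *)
Lemma foster : \sum_(e <- edges G) edge_res g e / elen e = (nv G)%:R - 1.
Proof.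
transitivity (\sum_(w < nv G) energy G (g w) (dirac_at R w)).
  rewrite /energy exchange_big; apply: eq_big_seq => e eG /=.
  have [an bn _] := metrized_edge mG eG.
  rewrite -mulr_suml; congr (_ / _).
  under eq_bigr => w _ do rewrite {2}/drop_along mulrBr.
  rewrite sumrB (sum_dirac_at (fun w => drop_along (g w) e) an).
  rewrite (sum_dirac_at (fun w => drop_along (g w) e) bn).
  by rewrite /edge_res /edge_pot /drop_along; ring.
under eq_bigr => w _ do rewrite (gP (ltn_ord w)).2 {1}/dirac_at eqxx.
rewrite sumrB big_const_ord iter_addr_0; congr (_ - _).
by rewrite -(sum_dirac_at (fun=> 1) pn); apply: eq_bigr => w _; rewrite mul1r.
Qed.

Lemma sum_cross_sqr k : k \in edges G ->
  \sum_(e <- edges G) cross e k ^+ 2 / elen e = edge_res g k.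
Proof.
move=> kG; rewrite /edge_res -(energy_edge_pot mG gP _ kG).
by apply: eq_big_seq => e eG; rewrite cross_sym // expr2.
Qed.

(** By symmetry of [g], h_e at [x] is the drop of [g x] along [e], so the sum is the energy of
    [g x]. *)
Lemma sum_edge_pot_sqr x : (x < nv G)%N ->
  \sum_(e <- edges G) edge_pot g e x ^+ 2 / elen e = g x x.
Proof.
move=> xn; have [x0 xE] := gP xn.
have -> : g x x = energy G (g x) (g x) by rewrite xE x0 subr0.
by apply: eq_big_seq => e eG; rewrite (edge_potE mG gP eG xn) expr2.
Qed.

Lemma sum_cross2 k : k \in edges G ->
  \sum_(e <- edges G) cross2 e k / elen e = edge_tilt g k.
Proof.
move=> kG; have [an bn _] := metrized_edge mG kG.
rewrite /edge_tilt /drop_along -(sum_edge_pot_sqr an) -(sum_edge_pot_sqr bn).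
by rewrite -sumrB; apply: eq_bigr => e _; rewrite -mulrBl.
Qed.

(* With [s], [t] the values of the potential at the ends of an edge,
   (s-t)^4/4 + 3/4 (s^2-t^2)^2 = (s-t)(s^3-t^3), so the sum is the energy
   pairing of the potential with its cube. *)
Lemma sum_cross_quartic e : e \in edges G ->
  \sum_(k <- edges G) (4^-1 * cross e k ^+ 4 + 3 / 4 * cross2 e k ^+ 2) / elen k
  = edge_res g e * elen e * y_local g e.
Proof.
move=> eG; have [_ _ L0] := metrized_edge mG eG.
transitivity (energy G (edge_pot g e) (fun x => edge_pot g e x ^+ 3)).
  apply: eq_bigr => k _; congr (_ / _).
  by rewrite /cross /cross2 /drop_along; field.
rewrite (energy_edge_pot mG gP _ eG) /y_local (edge_tiltE mG gP eG).
rewrite /edge_res /drop_along; field.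
by rewrite gt_eqF.
Qed.

Lemma edge_pot_loop e x : esrc e = etgt e -> edge_pot g e x = 0.
Proof. by rewrite /edge_pot => ->; rewrite subrr. Qed.

Lemma sum_admissible (F : nat * nat * R -> R) :
  (forall e, e \in edges G -> esrc e = etgt e -> F e = 0) ->
  \sum_(i < size (edges G) | admissible G i) F (edge_of G i) =
  \sum_(e <- edges G) F e.
Proof.
move=> F0; rewrite (big_nth (0%N, 0%N, 0)) big_mkord big_mkcond.
apply: eq_bigr => i _; case: ifP => // /negbFE/eqP ab.
by rewrite -/(edge_of G i) F0 // edge_of_mem.
Qed.

Lemma edge_res_loop e : esrc e = etgt e -> edge_res g e = 0.
Proof. by move=> ab; rewrite /edge_res /drop_along ab subrr. Qed.

Lemma sum_edge_res_average :
  \sum_(e <- edges G) edge_res g e / elen e *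
    \sum_(k <- edges G) (edge_res g k - cross e k ^+ 2 / edge_res g e)
  = ((nv G)%:R - 2) * \sum_(k <- edges G) edge_res g k.
Proof.
transitivity (\sum_(e <- edges G) \sum_(k <- edges G)
    (edge_res g e / elen e * edge_res g k - cross e k ^+ 2 / elen e)).
  apply: eq_big_seq => e eG; rewrite mulr_sumr; apply: eq_bigr => k _.
  have [_ _ L0] := metrized_edge mG eG.
  (* For a loop [edge_res g e] is 0 and cannot be cancelled, but h_e is 0 and both sides vanish. *)
  have [ab|ab] := eqVneq (esrc e) (etgt e).
    rewrite edge_res_loop // /cross /drop_along !edge_pot_loop // subrr expr0n.
    by rewrite !mul0r subr0.
  have r0 := edge_res_neq0 mG gP eG ab.
  by field; rewrite r0 gt_eqF.
rewrite exchange_big mulr_sumr; apply: eq_big_seq => k kG /=.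
by rewrite sumrB -mulr_suml foster sum_cross_sqr //; ring.
Qed.

Lemma sum_y_local_average :
  \sum_(e <- edges G) edge_res g e / elen e *
    \sum_(k <- edges G)
      (4^-1 * (edge_res g k - cross e k ^+ 2 / edge_res g e) ^+ 2
       + 3 / 4 * (edge_tilt g k - cross2 e k / edge_res g e) ^+ 2) / elen k
  = ((nv G)%:R - 2) * \sum_(k <- edges G) y_local g k.
Proof.
(* The squares are expanded. The quartic part is kept apart because it is summed over [k] first, the
   other terms over [e] first. *)
transitivity (\sum_(e <- edges G) \sum_(k <- edges G)
   (edge_res g e / elen e * y_local g k
    - 2 * (4^-1 * edge_res g k * (cross e k ^+ 2 / elen e)
           + 3 / 4 * edge_tilt g k * (cross2 e k / elen e)) / elen k)
  + \sum_(e <- edges G) (edge_res g e * elen e)^-1 *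
      \sum_(k <- edges G)
        (4^-1 * cross e k ^+ 4 + 3 / 4 * cross2 e k ^+ 2) / elen k).
  rewrite -big_split; apply: eq_big_seq => e eG /=.
  rewrite !mulr_sumr -big_split; apply: eq_big_seq => k kG /=.
  have [_ _ L0] := metrized_edge mG eG; have [_ _ l0] := metrized_edge mG kG.
  have [ab|ab] := eqVneq (esrc e) (etgt e).
    rewrite edge_res_loop // /cross /cross2 /drop_along !edge_pot_loop //.
    by rewrite subrr; ring.
  have r0 := edge_res_neq0 mG gP eG ab.
  by rewrite /y_local; field; rewrite r0 !gt_eqF.
have -> : \sum_(e <- edges G) (edge_res g e * elen e)^-1 *
      \sum_(k <- edges G)
        (4^-1 * cross e k ^+ 4 + 3 / 4 * cross2 e k ^+ 2) / elen k
   = \sum_(e <- edges G) y_local g e.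
  apply: eq_big_seq => e eG; rewrite sum_cross_quartic //.
  have [_ _ L0] := metrized_edge mG eG.
  have [ab|ab] := eqVneq (esrc e) (etgt e).
    rewrite /y_local edge_res_loop // /edge_tilt /drop_along ab subrr.
    by rewrite expr0n !mulr0 addr0 !mul0r mulr0.
  have r0 := edge_res_neq0 mG gP eG ab.
  by field; rewrite r0 gt_eqF.
(* For fixed [k] the sum over [e] now gives v - 1 from the leading term, -2 from the cross terms and
   +1 from the quartic part. *)
rewrite exchange_big mulr_sumr -big_split; apply: eq_big_seq => k kG /=.
have [_ _ l0] := metrized_edge mG kG.
rewrite sumrB -mulr_suml foster -mulr_suml -mulr_sumr big_split -!mulr_sumr /=.
by rewrite sum_cross_sqr // sum_cross2 // /y_local; field; rewrite gt_eqF.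
Qed.

Lemma sum_edges_ord (F : nat * nat * R -> R) :
  \sum_(i < size (edges G)) F (edge_of G i) = \sum_(e <- edges G) F e.
Proof. by rewrite (big_nth (0%N, 0%N, 0)) big_mkord. Qed.

Lemma yG_green : yG G p = \sum_(e <- edges G) y_local g e.
Proof.
rewrite -sum_edges_ord; apply: eq_bigr => i _.
exact: (edge_val_y mG pn gP (ltn_ord i)).
Qed.

Lemma xG_green :
  xG G p = \sum_(e <- edges G) edge_res g e - \sum_(e <- edges G) y_local g e.
Proof.
rewrite -sumrB -sum_edges_ord; apply: eq_bigr => i _.
exact: (edge_val_x mG pn gP (ltn_ord i)).
Qed.

End Averaging.

(** * One contraction, then induction on their number *)

Section OneContraction.
Variables (R : realType) (G : mgraph R) (p : nat).
Hypotheses (mG : metrized G) (pn : (p < nv G)%N).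

Lemma nested1_y : nested (@yG R) 1 G p = ((nv G)%:R - 2) * yG G p.
Proof.
have [g gP] := green_exists mG pn.
rewrite (yG_green mG pn gP) -(sum_y_local_average mG pn gP).
rewrite -sum_admissible => [|e eG ab]; last first.
  by rewrite edge_res_loop // !mul0r.
apply: eq_bigr => i adm; have iG := ltn_ord i.
rewrite (edge_val_ratio mG pn gP iG); congr (_ * _).
have mG1 := metrized_contract mG pn iG adm.
have pn1 := contract_vertex_lt mG iG adm pn.
have gP1 := contract_green_green mG pn gP iG adm.
by rewrite /= (yG_green mG1 pn1 gP1) (sum_y_local_contract mG gP iG adm).
Qed.

(** x is the sum of the r_e minus y, and both averages carry the same factor v - 2. *)
Lemma nested1_x : nested (@xG R) 1 G p = ((nv G)%:R - 2) * xG G p.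
Proof.
have [g gP] := green_exists mG pn.
rewrite (xG_green mG pn gP) mulrBr -(sum_y_local_average mG pn gP).
rewrite -(sum_edge_res_average mG pn gP) -sumrB.
rewrite -sum_admissible => [|e eG ab]; last first.
  by rewrite edge_res_loop // !mul0r subr0.
apply: eq_bigr => i adm; have iG := ltn_ord i.
rewrite -mulrBr (edge_val_ratio mG pn gP iG); congr (_ * _).
have mG1 := metrized_contract mG pn iG adm.
have pn1 := contract_vertex_lt mG iG adm pn.
have gP1 := contract_green_green mG pn gP iG adm.
rewrite /= (xG_green mG1 pn1 gP1) (sum_y_local_contract mG gP iG adm).
by rewrite (sum_edge_res_contract mG gP iG adm).
Qed.

End OneContraction.

(** The outermost contraction is peeled off: all contracted graphs have v - 1 vertices, so the
    factor from the induction hypothesis is the same for every edge and leaves the sum. *)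
Lemma nested_factorial (R : realType) (F : mgraph R -> nat -> R) :
  (forall G p, metrized G -> (p < nv G)%N ->
     nested F 1 G p = ((nv G)%:R - 2) * F G p) ->
  forall k (G : mgraph R) p, metrized G -> (p < nv G)%N -> (k.+2 <= nv G)%N ->
    ((nv G - 2)`!%:R / (nv G - k - 2)`!%:R) * F G p = nested F k G p.
Proof.
move=> F1; elim=> [|k IH] G p mG pn kn.
  by rewrite subn0 divff ?mul1r // pnatr_eq0 -lt0n fact_gt0.
(* The bound on [k] gives [k <= n], so the truncated subtractions below are exact. *)
have [n nE] : exists n, nv G = n.+3 by exists (nv G - 3)%N; lia.
have -> : nested F k.+1 G p =
    (n`!%:R / (nv G - k.+1 - 2)`!%:R) * nested F 1 G p.
  rewrite /= mulr_sumr; apply: eq_bigr => i adm.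
  have iG := ltn_ord i.
  have mG1 := metrized_contract mG pn iG adm.
  have pn1 := contract_vertex_lt mG iG adm pn.
  rewrite -IH //; last by rewrite /= nE /=; lia.
  rewrite [nv (Defs.contract G i)]/= nE [RHS]mulrCA.
  have -> : (n.+3.-1 - 2 = n)%N by lia.
  by have -> : (n.+3.-1 - k - 2 = n.+3 - k.+1 - 2)%N by lia.
rewrite F1 // nE.
have -> : (n.+3 - 2 = n.+1)%N by lia.
(* The factor v - 2 completes [n]! to [n.+1]!. *)
have -> : n.+3%:R - 2 = n.+1%:R :> R by rewrite -[n.+3]addn2 natrD addrK.
by rewrite factS natrM; ring.
Qed.

Theorem theorem3p11 (R : realType) (G : mgraph R) (p k : nat) :
  metrized G -> (3 <= nv G)%N -> (p < nv G)%N ->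
  (1 <= k)%N -> (k <= nv G - 2)%N ->
  ((nv G - 2)`!%:R / (nv G - k - 2)`!%:R) * xG G p = nested (@xG R) k G p /\
  ((nv G - 2)`!%:R / (nv G - k - 2)`!%:R) * yG G p = nested (@yG R) k G p.
Proof.
move=> mG n3 pn k1 kn; have kn2 : (k.+2 <= nv G)%N by lia.
split; apply: nested_factorial => // {mG n3 pn k1 kn kn2} G' p' mG' pn'.
- exact: nested1_x.
- exact: nested1_y.
Qed.
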